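(* Let $(V,m,b)$ be an infinite weighted directed graph satisfying the standing assumptions (locally finite, weakly connected, $\sum_{y}b(x,y)>0$ for all $x$, and Kirchhoff's assumption), and let $\overline{\Delta}$ be the closure of its Laplacian in $\ell^2(V,m)$. If $\overline{\Delta}$ is m-accretive, then $-\overline{\Delta}$ is the generator of a strongly continuous one-parameter contraction semigroup on $\ell^2(V,m)$, i.e. $\|\exp(-t\overline{\Delta})\|\le 1$ for all $t\ge 0$.
   Context: Graph: $V$ is a countable set, $b:V\times V\to[0,\infty)$ satisfies $b(x,x)=0$ for all $x$, and $m:V\to(0,\infty)$ is a weight on vertices. For $x\in V$, $V_x=\{y\in V: b(x,y)>0\text{ or }b(y,x)>0\}$. Standing assumptions: (1) locally finite: every $V_x$ is finite; (2) weakly connected: any two vertices are joined by a finite chain of undirected edges $\{x,y\}$ (pairs with $b(x,y)>0$ or $b(y,x)>0$); (3) $\sum_{y\in V}b(x,y)>0$ for all $x\in V$; (4) Kirchhoff's assumption: $\sum_{y}b(x,y)=\sum_{y}b(y,x)$ for all $x\in V$. Function spaces: $\mathcal C_c(V)$ is the set of finitely supported functions $V\to\mathbb C$; $\ell^2(V,m)$ is the Hilbert space of $f:V\to\mathbb C$ with $\sum_x m(x)|f(x)|^2<\infty$, with scalar product $\langle f,g\rangle=\sum_x m(x)f(x)\overline{g(x)}$. Laplacian: $\Delta$ is the operator on $\ell^2(V,m)$ with domain $\mathcal C_c(V)$, $\Delta f(x)=\frac{1}{m(x)}\sum_{y\in V}b(x,y)(f(x)-f(y))$. It is closable and $\overline{\Delta}$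 is its closure. An operator $A$ with domain $D(A)$ is accretive if $\operatorname{Re}\langle Af,f\rangle\ge 0$ for all $f\in D(A)$. An accretive operator $A$ is m-accretive if the open left half-plane is contained in its resolvent set and $\|(A+\lambda)^{-1}\|\le \frac{1}{\operatorname{Re}\lambda}$ for all $\lambda$ with $\operatorname{Re}\lambda>0$. $\exp(-t\overline{\Delta})$, $t\ge0$, denotes the semigroup generated by $-\overline{\Delta}$. *)

(* Defs.v *)
From HB Require Import structures.
From mathcomp Require Import all_boot all_order all_algebra.
From mathcomp Require Import all_classical all_reals all_analysis.
From mathcomp Require Import ring lra.
From mathcomp.real_closed Require Import complex.

Set Implicit Arguments.
Unset Strict Implicit.
Unset Printing Implicit Defensive.

Import Order.TTheory GRing.Theory Num.Theory.
Import numFieldNormedType.Exports.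
Import Normc.

Local Open Scope classical_set_scope.
Local Open Scope ring_scope.
Local Open Scope complex_scope.

Section SquareSummable.
Context {R : realType} {V : countType} (m : V -> {posnum R}).
Implicit Types (f g h : V -> R[i]) (a : R[i]).

Definition wsq f (x : V) : R := (m x)%:num * normc (f x) ^+ 2.

Definition sqsum f : \bar R := \esum_(x in [set: V]) (wsq f x)%:E.

Definition sqsummable : {pred V -> R[i]} := fun f => `[< (sqsum f < +oo)%E >].

Lemma wsq_ge0 f x : 0 <= wsq f x.
Proof. by rewrite mulr_ge0 ?sqr_ge0. Qed.

Lemma sqsum_ge0 f : (0 <= sqsum f)%E.
Proof. by apply: esum_ge0 => x _; rewrite lee_fin wsq_ge0. Qed.

Lemma sqsummableP f : reflect (sqsum f < +oo)%E (f \in sqsummable).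
Proof. exact: asboolP. Qed.

Lemma sqsum_fin f : f \in sqsummable -> sqsum f = (fine (sqsum f))%:E.
Proof.
by move=> /sqsummableP fs; rewrite fineK// ge0_fin_numE// sqsum_ge0.
Qed.

Lemma le_sqsum (p q : R) f g h : 0 <= p -> 0 <= q ->
  (forall x, wsq h x <= p * wsq f x + q * wsq g x) ->
  (sqsum h <= p%:E * sqsum f + q%:E * sqsum g)%E.
Proof.
move=> p0 q0 hfg; rewrite /sqsum/esum.
apply: ge_ereal_sup => _ [X [finX XV] <-].
apply: (@le_trans _ _
  (\sum_(x \in X) (p%:E * (wsq f x)%:E + q%:E * (wsq g x)%:E))%E).
  by apply: lee_fsum => // x _; rewrite -!EFinM -EFinD lee_fin.
rewrite fsbig_split//= -!ge0_mule_fsumr; do ?by move=> x; rewrite lee_fin wsq_ge0.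
by apply: leeD; apply: lee_wpmul2l => //; apply: ereal_sup_ubound; exists X.
Qed.

Lemma le_fine_sqsum (p q : R) f g h : f \in sqsummable -> g \in sqsummable ->
  0 <= p -> 0 <= q -> (forall x, wsq h x <= p * wsq f x + q * wsq g x) ->
  h \in sqsummable /\
  fine (sqsum h) <= p * fine (sqsum f) + q * fine (sqsum g).
Proof.
move=> fs gs p0 q0 /(le_sqsum p0 q0); rewrite (sqsum_fin fs) (sqsum_fin gs).
rewrite -!EFinM -EFinD => hle.
have hs : h \in sqsummable by apply/sqsummableP; rewrite (le_lt_trans hle) ?ltry.
by split => //; move: hle; rewrite (sqsum_fin hs) lee_fin.
Qed.

Lemma wsqD (s : R) f g x : 0 < s ->
  wsq (f + g) x <= (1 + s) * wsq f x + (1 + s^-1) * wsq g x.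
Proof.
move=> s0; rewrite /wsq !(mulrCA _ (m x)%:num) -mulrDr ler_wpM2l//=.
set u := normc (f x); set v := normc (g x).
have u0 : 0 <= u by rewrite /u; case: (f x) => ? ?; exact: sqrtr_ge0.
have v0 : 0 <= v by rewrite /v; case: (g x) => ? ?; exact: sqrtr_ge0.
have := @le_normcD _ (f x) (g x); rewrite -/u -/v => uv.
have w0 : 0 <= normc ((f + g) x) by case: ((f + g) x) => ? ?; exact: sqrtr_ge0.
apply: (@le_trans _ _ ((u + v) ^+ 2)); first by rewrite lerXn2r ?nnegrE ?addr_ge0.
rewrite -subr_ge0 (_ : _ - _ = s^-1 * (s * u - v) ^+ 2); last first.
  by field; rewrite gt_eqF.
by rewrite mulr_ge0 ?sqr_ge0// invr_ge0 ltW.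
Qed.

Lemma wsqZ a f x : wsq (a *: f) x = normc a ^+ 2 * wsq f x.
Proof. by rewrite /wsq [RHS]mulrCA -exprMn -normcM. Qed.

Lemma wsq0 x : wsq 0 x = 0.
Proof. by rewrite /wsq normc0 expr0n mulr0. Qed.

Lemma sqsummable0 : 0 \in sqsummable.
Proof.
apply/sqsummableP; rewrite /sqsum esum1 ?ltry// => x _.
by rewrite wsq0.
Qed.

Lemma sqsummable_submod : submod_closed sqsummable.
Proof.
split=> [|a f g fs gs]; first exact: sqsummable0.
have p0 : 0 <= 2 * normc a ^+ 2 by rewrite mulr_ge0 ?sqr_ge0.
have fgx x : wsq (a *: f + g) x <= 2 * normc a ^+ 2 * wsq f x + 2 * wsq g x.
  by apply: (le_trans (wsqD _ _ _ ltr01)); rewrite wsqZ invr1 mulrA.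
by have [] := le_fine_sqsum fs gs p0 (ler0n _ 2) fgx.
Qed.

HB.instance Definition _ := GRing.isSubmodClosed.Build _ _ sqsummable
  sqsummable_submod.

(* The norm of l2 m is R[i]-valued, as it is for any normedModType R[i]; it is
   the one induced by the scalar product l2dot (see l2dotff). *)
Record l2 := L2 { l2fun :> V -> R[i]; _ : l2fun \in sqsummable }.

HB.instance Definition _ := [isSub for l2fun].
HB.instance Definition _ := [Choice of l2 by <:].
HB.instance Definition _ := [SubChoice_isSubLmodule of l2 by <:].

Definition l2norm (f : l2) : R := Num.sqrt (fine (sqsum f)).

Implicit Types (u v : l2).

Let nsq u := fine (sqsum u).

Let nsq_ge0 u : 0 <= nsq u.
Proof. exact/fine_ge0/sqsum_ge0. Qed.

Lemma le_l2norm_sqr u v (p q : R) (w : l2) : 0 <= p -> 0 <= q ->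
  (forall x, wsq w x <= p * wsq u x + q * wsq v x) ->
  l2norm w ^+ 2 <= p * l2norm u ^+ 2 + q * l2norm v ^+ 2.
Proof.
move=> p0 q0 wuv; rewrite !sqr_sqrtr ?nsq_ge0//.
by have [] := le_fine_sqsum (valP u) (valP v) p0 q0 wuv.
Qed.

Lemma wsq_le_l2norm u x : wsq u x <= l2norm u ^+ 2.
Proof.
rewrite sqr_sqrtr ?nsq_ge0// -lee_fin -(sqsum_fin (valP u)).
apply: esum_ge; exists [set x]; last by rewrite fsbig_set1.
by split => //; exact: finite_set1.
Qed.

Lemma l2P u v : (forall x, u x = v x) -> u = v.
Proof. by move=> uv; apply/val_inj/funext. Qed.

Lemma l2norm_eq0 u : l2norm u = 0 -> u = 0.
Proof.
move=> u0; apply: l2P => x; have := wsq_le_l2norm u x.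
rewrite u0 expr0n /= /wsq => ux; apply: eq0_normc; apply/eqP.
by rewrite -sqrf_eq0 eq_le sqr_ge0 andbT -(pmulr_rle0 _ (gt0 (m x))).
Qed.

Lemma l2normD u v : l2norm (u + v) <= l2norm u + l2norm v.
Proof.
have [u0|u0] := eqVneq (l2norm u) 0.
  by rewrite (l2norm_eq0 u0) add0r lerDr sqrtr_ge0.
have [v0|v0] := eqVneq (l2norm v) 0.
  by rewrite (l2norm_eq0 v0) addr0 lerDl sqrtr_ge0.
have up : 0 < l2norm u by rewrite lt_def u0 sqrtr_ge0.
have vp : 0 < l2norm v by rewrite lt_def v0 sqrtr_ge0.
rewrite -(@ler_pXn2r _ 2) ?nnegrE ?addr_ge0 ?sqrtr_ge0//.
pose s := l2norm v / l2norm u.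
have s0 : 0 < s by rewrite divr_gt0.
apply: (le_trans (@le_l2norm_sqr u v (1 + s) (1 + s^-1) _ _ _ _)).
- by rewrite addr_ge0 // ltW.
- by rewrite addr_ge0 // invr_ge0 ltW.
- by move=> x; exact: wsqD.
- by rewrite le_eqVlt; apply/orP; left; apply/eqP; rewrite /s; field; rewrite u0.
Qed.

Lemma l2normZ a u : l2norm (a *: u) = normc a * l2norm u.
Proof.
have na b : 0 <= normc b :> R by case: b => ? ?; exact: sqrtr_ge0.
have le b w : l2norm (b *: w) <= normc b * l2norm w.
  rewrite -(@ler_pXn2r _ 2) ?nnegrE ?mulr_ge0 ?sqrtr_ge0// exprMn.
  have := @le_l2norm_sqr w 0 (normc b ^+ 2) 0 (b *: w) (sqr_ge0 _) (lexx _).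
  rewrite mul0r addr0; apply => x.
  by rewrite mul0r addr0 wsqZ.
apply/eqP; rewrite eq_le le/=.
have [->|a0] := eqVneq a 0; first by rewrite normc0 mul0r sqrtr_ge0.
have na0 : 0 < normc a.
  by rewrite lt_def na andbT; apply: contra_neq a0 => /eq0_normc.
rewrite -ler_pdivlMl// -normcV; apply: le_trans (le _ _).
by rewrite scalerA mulVf// scale1r.
Qed.

Definition l2cnorm u : R[i] := (l2norm u)%:C.

Let l2cnormD u v : l2cnorm (u + v) <= l2cnorm u + l2cnorm v.
Proof. by rewrite -rmorphD lecR l2normD. Qed.

Let l2cnormZ a u : l2cnorm (a *: u) = `|a| * l2cnorm u.
Proof. by rewrite /l2cnorm l2normZ rmorphM; case: a. Qed.

Let l2cnorm_eq0 u : l2cnorm u = 0 -> u = 0.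
Proof. by move=> /complexI/l2norm_eq0. Qed.

HB.instance Definition _ := Lmodule_isNormed.Build R[i] l2
  l2cnormD l2cnormZ l2cnorm_eq0.

(* Sum over V of a summable real family, resp. of a summable complex family. *)
Definition rsum (c : V -> R) : R :=
  fine (\esum_(x in [set: V]) (EFin \o c)^\+ x)%E -
  fine (\esum_(x in [set: V]) (EFin \o c)^\- x)%E.

Definition csum (c : V -> R[i]) : R[i] :=
  rsum (fun x => complex.Re (c x)) +i* rsum (fun x => complex.Im (c x)).

Definition l2dot u v : R[i] := csum (fun x => (m x)%:num%:C * u x * (v x)^*).

Lemma l2dotff u : l2dot u u = `|u| ^+ 2.
Proof.
have uE x : (m x)%:num%:C * u x * (u x)^* = (wsq u x)%:C.
  by rewrite -mulrA -sqr_normc /wsq rmorphM rmorphXn/=; case: (u x).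
rewrite -[`|u|]/(l2cnorm u) /l2cnorm -rmorphXn/= sqr_sqrtr ?nsq_ge0//.
rewrite /l2dot/csum; under [X in rsum X +i* _]funext do rewrite uE.
under [X in _ +i* rsum X]funext do rewrite uE.
congr (_ +i* _); rewrite /rsum/=.
  rewrite [X in _ - fine X](esum1 _) ?subr0.
    congr fine; apply: eq_esum => x _.
    by rewrite funeposE /= max_l// lee_fin wsq_ge0.
  by move=> x _; rewrite funenegE /= max_r// lee_fin oppr_le0 wsq_ge0.
by rewrite !esum1 ?subrr// => x _; rewrite ?funeposE ?funenegE /= ?oppr0 maxxx.
Qed.

Lemma finite_support_sqsummable f :
  finite_set [set x | f x != 0] -> f \in sqsummable.
Proof.
move=> finf; apply/sqsummableP.
rewrite /sqsum (_ : \esum_(x in _) _ =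
   (\esum_(x in [set x | f x != 0%R]) (wsq f x)%:E)%E).
  by rewrite esum_fset// => *; rewrite ?lee_fin ?wsq_ge0// fsumEFin// ltry.
rewrite [RHS]esum_mkcond; apply: eq_esum => x _.
case: ifPn => //; rewrite notin_setE/= => /negP; rewrite negbK => /eqP fx.
by rewrite /wsq fx normc0 expr0n mulr0.
Qed.

Lemma l2_eval_continuous (x : V) : continuous (fun u => u x : R[i]^o).
Proof.
move=> u; apply/(@cvgrPdist_lt _ _ _ (nbhs u)) => e e0.
have eE : e = (complex.Re e)%:C by rewrite RRe_real// gtr0_real.
have Re0 : 0 < complex.Re e by move: e0; rewrite eE ltcR.
have s0 : 0 < Num.sqrt (m x)%:num by rewrite sqrtr_gt0.
near=> v.
have : `|u - v| < (complex.Re e * Num.sqrt (m x)%:num)%:C.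
  by near: v; apply: cvgr_dist_lt; rewrite ?ltcR ?mulr_gt0//; exact: cvg_id.
rewrite -[`|u - v|]/(l2cnorm (u - v)) ltcR => uv; rewrite eE.
have -> : `|(u x : R[i]^o) - v x| = (normc ((u - v) x))%:C.
  by rewrite -[u x - v x]/((u - v) x); case: ((u - v) x).
have n0 : 0 <= normc ((u - v) x) by case: ((u - v) x) => ? ?; exact: sqrtr_ge0.
rewrite ltcR -(ltr_pM2r s0) (le_lt_trans _ uv)//.
rewrite -(@ler_pXn2r _ 2) ?nnegrE ?sqrtr_ge0 ?mulr_ge0 ?sqrtr_ge0//.
by rewrite exprMn sqr_sqrtr// mulrC; exact: wsq_le_l2norm.
Unshelve. all: by end_near. Qed.

End SquareSummable.

(* An operator on E, with its domain, is given by its graph: A (f, g) means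
   that f belongs to the domain and A f = g.  In particular the graph of the
   closure of A is the topological closure of A in E * E. *)
Section Operators.
Context {R : realType} {E : normedModType R[i]}.
Implicit Types (A : set (E * E)) (z : R[i]) (T : R -> {linear E -> E}).

Definition opnorm (B : E -> E) : \bar R :=
  ereal_sup [set (complex.Re `|B f|)%:E | f in [set f : E | `|f| <= 1]].

Definition opp_op A : set (E * E) := [set p : E * E | A (p.1, - p.2)].

(* A + z *)
Definition shift_op A z : set (E * E) := [set p : E * E | A (p.1, p.2 - z *: p.1)].

Definition is_inverse A (B : E -> E) := forall f g, A (f, g) <-> B g = f.

Definition resolvent_set A : set R[i] :=
  [set z | exists B : {linear E -> E},
     continuous B /\ is_inverse (shift_op A (- z)) B].

Record C0_semigroup T : Prop := {
  C0_continuous : forall t : R, 0 <= t -> continuous (T t) ;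
  C0_0 : forall f, T 0 f = f ;
  C0_D : forall (s t : R) f, 0 <= s -> 0 <= t -> T (s + t) f = T s (T t f) ;
  C0_strong : forall f, {within [set t : R | 0 <= t], continuous (T ^~ f)} }.

Definition generator T : set (E * E) :=
  [set p : E * E | (t^-1)%:C *: (T t p.1 - p.1) @[t --> 0^'+] --> p.2].

End Operators.

Section Accretive.
Context {R : realType} {V : countType} {m : V -> {posnum R}}.
Implicit Types A : set (l2 m * l2 m).

Definition accretive A := forall f g, A (f, g) -> 0 <= complex.Re (l2dot g f).

Definition m_accretive A :=
  [/\ accretive A,
      [set z | complex.Re z < 0] `<=` resolvent_set A &
      forall z (B : l2 m -> l2 m), 0 < complex.Re z ->
        is_inverse (shift_op A z) B ->
        (opnorm B <= ((complex.Re z)^-1)%:E)%E].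

End Accretive.

Section Digraph.
Context {R : realType} {V : countType} (b : V -> V -> {nonneg R}).

Definition edge : rel V := fun x y => (0 < (b x y)%:num) || (0 < (b y x)%:num).

Definition locally_finite := forall x, finite_set [set y | edge x y].

Definition weakly_connected :=
  forall x y, exists p : seq V, path edge x p /\ last x p = y.

(* Under local finiteness the families summed below have finite support. *)
Definition kirchhoff := forall x,
  \sum_(y \in [set: V]) (b x y)%:num = \sum_(y \in [set: V]) (b y x)%:num.

Definition lap (m : V -> {posnum R}) (f : V -> R[i]) (x : V) : R[i] :=
  ((m x)%:num^-1)%:C *
  \sum_(y \in [set: V]) (b x y)%:num%:C * (f x - f y).

(* The value of the Laplacian is required to be in l2 m; this does not restrict
   the domain C_c(V), by lap_domain. *)
Definition laplacian (m : V -> {posnum R}) : set (l2 m * l2 m) :=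
  [set p : l2 m * l2 m | finite_set [set x | p.1 x != 0] /\
    (p.2 : V -> R[i]) =1 lap m p.1].

End Digraph.

Arguments laplacian {R V} b m _.

Section LaplacianTheory.
Context {R : realType} {V : countType} (b : V -> V -> {nonneg R}).

Lemma lap_finE (m : V -> {posnum R}) f x (xf : finite_set [set y | edge b x y]) :
  lap b m f x = ((m x)%:num^-1)%:C *
    \sum_(y <- finmap.enum_fset (fset_set [set y | edge b x y])) (b x y)%:num%:C * (f x - f y).
Proof.
congr (_ * _); rewrite -fsbig_finite//; apply/esym/fsbig_widen => // y [_].
move=> /= /negP; rewrite negb_or -leNgt => /andP[bxy _].
by rewrite (_ : (b x y)%:num = 0) ?mul0r//; apply/eqP; rewrite eq_le bxy/=.
Qed.

Lemma lap_domain (m : V -> {posnum R}) (f : V -> R[i]) : locally_finite b ->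
  finite_set [set x | f x != 0] ->
  exists u v : l2 m, (u : V -> R[i]) =1 f /\ laplacian b m (u, v).
Proof.
move=> lf ff.
have lapf : finite_set [set x | lap b m f x != 0].
  apply: (@sub_finite_set _ _ ([set x | f x != 0] `|`
     \bigcup_(y in [set x | f x != 0]) [set x | edge b y x])).
    move=> x /=; apply: contraPP; rewrite not_orE => -[/negP].
    rewrite negbK => /eqP fx nedge; apply/negP; rewrite negbK.
    rewrite /lap fsbig1 ?mulr0// => y _; rewrite fx sub0r.
    have [->|fy] := eqVneq (f y) 0; first by rewrite oppr0 mulr0.
    have [->|bxy] := eqVneq (b x y)%:num 0; first by rewrite mul0r.
    exfalso; apply: nedge; exists y => //=.
    by rewrite /edge !lt_def bxy !ge0 orbT.
  by rewrite finite_setU; split => //; exact: bigcup_finite.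
exists (L2 (finite_support_sqsummable m ff)).
by exists (L2 (finite_support_sqsummable m lapf)).
Qed.

Lemma laplacian_closable (m : V -> {posnum R}) : locally_finite b ->
  forall u v w, closure (laplacian b m) (u, v) ->
  closure (laplacian b m) (u, w) -> v = w.
Proof.
move=> lf; suff H u v : closure (laplacian b m) (u, v) -> v =1 lap b m u.
  by move=> u v w /H uv /H uw; apply: l2P => x; rewrite uv uw.
move=> + x; pose D (p : l2 m * l2 m) : R[i]^o := p.2 x - lap b m p.1 x.
suff cD : closed (D @^-1` [set 0]).
  move=> Luv; have /cD : closure (D @^-1` [set 0]) (u, v).
    apply: closureS Luv => -[p q] [_ pq].
    by rewrite /D /preimage/= pq subrr.
  by move=> /eqP; rewrite subr_eq0 => /eqP.
apply: preimage_closed; last first.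
  by apply: accessible_closed_set1; exact/hausdorff_accessible/norm_hausdorff.
have ev1 y : continuous (fun p : l2 m * l2 m => p.1 y : R[i]^o).
  by move=> p; exact: (continuous_comp cvg_fst (@l2_eval_continuous _ _ _ y _)).
have evS (F : V -> l2 m * l2 m -> R[i]^o) (r : seq V) :
    (forall y, continuous (F y)) -> continuous (fun p => \sum_(y <- r) F y p : R[i]^o).
  move=> cF; elim: r => [|y r IH] p.
    by under eq_fun do rewrite big_nil; exact: cvg_cst.
  under eq_fun do rewrite big_cons.
  by apply: cvgD; [exact: cF|exact: IH].
move=> p _; apply: cvgB.
  exact: (continuous_comp cvg_snd (@l2_eval_continuous _ _ _ x _)).
under eq_fun do rewrite (lap_finE _ _ (lf x)).
rewrite (lap_finE _ _ (lf x)).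
apply: (@cvgZl_tmp _ R[i]^o).
apply: (evS (fun y p => (b x y)%:num%:C *: (p.1 x - p.1 y : R[i]^o))) => y q.
by apply: cvgZl_tmp; apply: cvgB; exact: ev1.
Qed.

End LaplacianTheory.

(* Main.v *)
Require Import Defs.
From HB Require Import structures.
From mathcomp Require Import all_boot all_order all_algebra.
From mathcomp Require Import all_classical all_reals all_analysis.
From mathcomp Require Import ring lra.
From mathcomp.real_closed Require Import complex.

Import Order.TTheory GRing.Theory Num.Theory.
Import numFieldNormedType.Exports.
Import Normc.

Local Open Scope classical_set_scope.
Local Open Scope ring_scope.
Local Open Scope complex_scope.

(** The theorem is the contraction case of the Hille-Yosida theorem
    ([hille_yosida]), applied in the Banach space l2 m: the finitely supported
    functions lie in the domain of the closed Laplacian and are dense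
    ([finite_support_approx]), and m-accretivity supplies the resolvent bound
    that the Hille-Yosida theorem asks for.

    For a relation A on a Banach space, let J r = (1 + r A)^-1, a contraction for
    each r >= 0.  The semigroup is obtained from backward Euler steps,
    T t f = lim_k (J (t / 2^k))^(2^k) f, restricted to dyadic subdivisions so
    that everything follows from one identity, valid for f in the domain of A^2
    ([resolvent_split]):
      J (r + s) f - J r (J s f) = r s J r (J s (J (r + s) (A^2 f))).
    It expands (1 + r A) (1 + s A) = 1 + (r + s) A + r s A^2.  All maps being
    contractions, n factors J (r + s) may be exchanged for n factors J r J s at
    the cost n r s |A^2 f| ([iter_resolvent_split]).
    - With r = s = t / 2^(k+1) and n = 2^k the cost is O(2^-k), so the Euler
      approximations are a Cauchy sequence on the domain of A^2, hence everywhere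
      because that domain is dense and the approximations are contractions.
    - With r = s0 / 2^k, s = t0 / 2^k and n = 2^k the cost again vanishes, and as
      resolvents commute this gives T (s0 + t0) = T s0 T t0.

    That -A is part of the generator comes from T t f = J t f + O(t^2) on the
    domain of A^2 together with |T t f - f| <= t |A f| on the domain of A.  There
    is nothing else in the generator: 1 + A is onto, whereas G f = f forces f = 0
    for the generator G of a contraction semigroup. *)

(** * The norm as a real number *)

Section RealNorm.
Context {R : realType} {E : normedModType R[i]}.
Implicit Types (f g l : E) (a : R).

Definition rnorm f : R := complex.Re `|f|.

Lemma rnormE f : `|f| = (rnorm f)%:C.
Proof. by rewrite RRe_real// ger0_real. Qed.

Lemma rnorm_ge0 f : 0 <= rnorm f.
Proof. by rewrite -lecR -rnormE; exact: normr_ge0. Qed.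

Lemma rnormD f g : rnorm (f + g) <= rnorm f + rnorm g.
Proof. by rewrite -lecR rmorphD/= -!rnormE; exact: ler_normD. Qed.

Lemma rnormZ a f : rnorm (a%:C *: f) = `|a| * rnorm f.
Proof.
apply: complexI; rewrite rmorphM/= -!rnormE normrZ; congr (_ * _).
by rewrite normc_def/= expr0n/= addr0 sqrtr_sqr.
Qed.

Lemma rnormN f : rnorm (- f) = rnorm f.
Proof. by rewrite /rnorm normrN. Qed.

Lemma rnormB f g : rnorm (f - g) = rnorm (g - f).
Proof. by rewrite /rnorm distrC. Qed.

Lemma rnorm0 : rnorm 0 = 0.
Proof. by rewrite /rnorm normr0. Qed.

Lemma rnorm_eq0 f : rnorm f = 0 -> f = 0.
Proof. by move=> f0; apply/eqP; rewrite -normr_eq0 rnormE f0. Qed.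

Lemma rnorm_trans g f l : rnorm (f - l) <= rnorm (f - g) + rnorm (g - l).
Proof. by rewrite (le_trans _ (rnormD _ _))// addrA subrK. Qed.

Lemma cvg_rnormP {T : Type} (F : set_system T) {FF : Filter F} (u : T -> E) l :
  (u @ F --> l) <-> (forall e : R, 0 < e -> \forall x \near F, rnorm (l - u x) < e).
Proof.
split=> [ul e e0|ul].
  have /cvgrPdist_lt/(_ e%:C) := ul; rewrite ltcR => /(_ e0).
  by apply: filterS => x; rewrite rnormE ltcR.
apply/cvgrPdist_lt => e e0.
have eE : e = (complex.Re e)%:C by rewrite RRe_real// gtr0_real.
move: e0; rewrite eE ltcR => /ul; apply: filterS => x.
by rewrite rnormE ltcR.
Qed.

Lemma rnorm_lim_le {T : Type} (F : set_system T) {FF : ProperFilter F}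
    (u : T -> E) f l (c : R) :
  u @ F --> l -> (\forall x \near F, rnorm (f - u x) <= c) -> rnorm (f - l) <= c.
Proof.
move=> /cvg_rnormP ul uc; apply/ler_addgt0Pr => e e0.
have [x [fx lx]] := filter_ex (filterI uc (ul _ e0)).
by rewrite (le_trans (rnorm_trans (u x) _ _))// lerD// rnormB ltW.
Qed.

Lemma contraction_continuous (B : {linear E -> E}) :
  (forall f, rnorm (B f) <= rnorm f) -> continuous B.
Proof.
move=> Bc f; apply/cvg_rnormP => e e0.
have /cvg_rnormP/(_ _ e0) : x @[x --> f] --> f by exact: cvg_id.
by apply: filterS => x; rewrite -linearB; exact: le_lt_trans.
Qed.

Lemma opnorm_rnorm (B : {linear E -> E}) (c : R) : 0 <= c ->
  (opnorm B <= c%:E)%E <-> (forall f, rnorm (B f) <= c * rnorm f).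
Proof.
move=> c0; split=> [Bc f|Bc]; last first.
  apply: ge_ereal_sup => _ [f f1 <-]; rewrite lee_fin.
  rewrite (le_trans (Bc f))// ler_piMr// -lecR -rnormE.
  exact: f1.
have [f0|f0] := eqVneq (rnorm f) 0.
  by rewrite (rnorm_eq0 _ f0) linear0 rnorm0 mulr0.
have fp : 0 < rnorm f by rewrite lt_def f0 rnorm_ge0.
have : ((rnorm (B ((rnorm f)^-1%:C *: f)))%:E <= c%:E)%E.
  apply: le_trans Bc; apply: ereal_sup_ubound.
  exists ((rnorm f)^-1%:C *: f) => //=.
  by rewrite rnormE rnormZ ger0_norm ?invr_ge0 ?rnorm_ge0// mulVf//; exact: lexx.
rewrite linearZ rnormZ ger0_norm ?invr_ge0 ?rnorm_ge0// lee_fin.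
by rewrite ler_pdivrMl// mulrC.
Qed.

End RealNorm.

Lemma geometric_small {R : realType} (c e : R) : 0 < e ->
  exists K, forall k, (K <= k)%N -> c / 2 ^+ k < e.
Proof.
move=> e0; exists (Num.bound `|c / e|) => k Kk.
rewrite ltr_pdivrMr ?exprn_gt0// -ltr_pdivrMl// mulrC.
apply: (le_lt_trans (ler_norm _)).
apply: (lt_le_trans (archi_boundP (normr_ge0 _))).
rewrite -natrX ler_nat (leq_trans _ (leq_pexp2l _ Kk))//.
exact/ltnW/ltn_expl.
Qed.

(** * Resolvents of a linear relation *)

(** Graph of the square of the operator whose graph is [A]. *)
Definition rel_sqr {E : Type} (A : set (E * E)) (f h : E) :=
  exists2 g, A (f, g) & A (g, h).

(** [J r] is (1 + r A)^-1, extended by the identity to r <= 0, where r = 0 is the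
    value demanded by the formula and r < 0 is a default that keeps [J r] a
    linear contraction for every r. *)
Record resolvent_family {R : realType} {E : normedModType R[i]}
    (A : set (E * E)) (J : R -> {linear E -> E}) : Prop := {
  resolventP : forall r f g, 0 < r -> A (f, g) <-> J r (f + r%:C *: g) = f ;
  resolvent_id : forall r f, r <= 0 -> J r f = f ;
  resolvent_contr : forall r f, rnorm (J r f) <= rnorm f ;
  resolvent_dense : forall f (e : R), 0 < e ->
    exists u v, A (u, v) /\ rnorm (f - u) < e }.

Arguments resolventP {R E A J} _.
Arguments resolvent_id {R E A J} _.
Arguments resolvent_contr {R E A J} _.
Arguments resolvent_dense {R E A J} _.

Section Resolvent.
Context {R : realType} {E : normedModType R[i]} {A : set (E * E)}
  {J : R -> {linear E -> E}} (AJ : resolvent_family A J).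
Implicit Types (f g h u v : E) (r s t e : R).

Let J1 := resolvent_contr AJ.

Lemma resolvent_dom r f : 0 < r -> A (J r f, r^-1%:C *: (f - J r f)).
Proof.
move=> r0; apply/(resolventP AJ _ _ _ r0); rewrite scalerA -rmorphM divff ?gt_eqF//.
by rewrite scale1r addrC subrK.
Qed.

(** The graph of J 1 is linear, and [A] is its image under a linear change of
    variables. *)
Lemma rel_linear (a : R[i]) f g u v : A (f, g) -> A (u, v) ->
  A (a *: f + u, a *: g + v).
Proof.
have A1 := resolventP AJ _ _ _ ltr01.
move=> /A1 fg /A1 uv; apply/A1; move: fg uv; rewrite !scale1r => fg uv.
by rewrite addrACA -scalerDr linearD linearZ/= fg uv.
Qed.

Lemma resolvent_eq r f g : 0 <= r -> A (f, g) -> J r (f + r%:C *: g) = f.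
Proof.
rewrite le_eqVlt => /predU1P[<-|r0] fg; last exact/(resolventP AJ).
by rewrite scale0r addr0 (resolvent_id AJ).
Qed.

Lemma resolvent_sub r f g : 0 <= r -> A (f, g) -> f - J r f = r%:C *: J r g.
Proof.
move=> r0 fg; rewrite -{1}(resolvent_eq r f g r0 fg).
by rewrite linearD addrC addKr linearZ.
Qed.

Lemma rel_resolvent r f g : A (f, g) -> A (J r f, J r g).
Proof.
have [r0|r0] := leP r 0; first by rewrite !(resolvent_id AJ).
move=> fg; have := resolvent_dom r f r0.
rewrite (resolvent_sub r f g (ltW r0) fg) scalerA -rmorphM.
by rewrite mulVf ?gt_eqF// scale1r.
Qed.

(** [A] commutes with J r ([rel_resolvent]), hence so does (1 + s A)^-1. *)
Lemma resolvent_comm r s f : J r (J s f) = J s (J r f).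
Proof.
have [s0|s0] := leP s 0; first by rewrite !(resolvent_id AJ s).
have := rel_resolvent r _ _ (resolvent_dom s f s0).
move/(resolventP AJ _ _ _ s0); rewrite linearZ/= scalerA -rmorphM divff ?gt_eqF//.
by rewrite scale1r linearB/= addrC subrK.
Qed.

Lemma resolvent_dist r f g : 0 <= r -> A (f, g) -> rnorm (f - J r f) <= r * rnorm g.
Proof.
move=> r0 fg; rewrite (resolvent_sub r f g)// rnormZ ger0_norm//.
by rewrite ler_wpM2l.
Qed.

(** J r tends to the identity strongly as r -> 0: on the domain of [A] this is
    [resolvent_dist], and the domain is dense. *)
Lemma resolvent_approx f e : 0 < e ->
  exists2 r, 0 < r & rnorm (f - J r f) < e.
Proof.
move=> e0; have e4 : 0 < e / 4 by rewrite divr_gt0.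
have [u [v [uv fu]]] := resolvent_dense AJ f _ e4.
have v1 : 0 < rnorm v + 1 by rewrite ltr_wpDl// rnorm_ge0.
exists (e / 4 / (rnorm v + 1)); first by rewrite divr_gt0.
set r := _ / _; have r0 : 0 < r by rewrite divr_gt0.
have := rnorm_trans u f (J r f); have := rnorm_trans (J r u) u (J r f).
have := resolvent_dist r u v (ltW r0) uv.
have := J1 r (u - f); rewrite linearB/= [rnorm (u - f)]rnormB.
have : r * rnorm v <= e / 4.
  by rewrite /r mulrAC ler_pdivrMr// ler_pM2l// lerDl.
lra.
Qed.

Lemma rel_sqr_resolvent r f h : rel_sqr A f h -> rel_sqr A (J r f) (J r h).
Proof. by case=> g fg gh; exists (J r g); exact: rel_resolvent. Qed.

(** J r maps the domain of [A] into the domain of its square. *)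
Lemma rel_sqr_dense f e : 0 < e ->
  exists u h, rel_sqr A u h /\ rnorm (f - u) < e.
Proof.
move=> e0; have e2 : 0 < e / 2 by rewrite divr_gt0.
have [u [v [uv fu]]] := resolvent_dense AJ f _ e2.
have [r r0 ru] := resolvent_approx u _ e2.
exists (J r u), (r^-1%:C *: (v - J r v)); split.
  exists (J r v); [exact: rel_resolvent|exact: resolvent_dom].
by rewrite (le_lt_trans (rnorm_trans u _ _))// [ltRHS]splitr ltrD.
Qed.

(** The whole construction rests on this identity.  Applied to a = J (r + s) f,
    the factor (1 + s A) (1 + r A) = 1 + (r + s) A + r s A^2 turns a into
    f + r s A^2 a, and J r J s turns it back into a. *)
Lemma resolvent_split r s f h : 0 <= r -> 0 <= s -> rel_sqr A f h ->
  J (r + s) f - J r (J s f) = (r * s)%:C *: J r (J s (J (r + s) h)).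
Proof.
move=> r0 s0 [g fg gh].
set a := J (r + s) f; set b := J (r + s) g; set c := J (r + s) h.
have ab : A (a, b) by exact: rel_resolvent.
have bc : A (b, c) by exact: rel_resolvent.
have fE : f = a + (r + s)%:C *: b.
  by rewrite /b -(resolvent_sub (r + s) f g) ?addr_ge0// /a addrC subrK.
have aE : J r (J s (a + s%:C *: b + r%:C *: (b + s%:C *: c))) = a.
  rewrite [J s _]linearD [J s (r%:C *: _)]linearZ /=.
  by rewrite (resolvent_eq s a b)// (resolvent_eq s b c)// (resolvent_eq r a b).
rewrite -{1}aE -[J r _ - _]linearB -[J s _ - _]linearB.
have -> : (r * s)%:C *: J r (J s c) = J r (J s ((r * s)%:C *: c)).
  by rewrite [J s (_ *: c)]linearZ [J r (_ *: _)]linearZ.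
congr (J r (J s _)); rewrite fE rmorphD rmorphM/= scalerDl scalerDr scalerA.
apply/(canLR (addrK _)); rewrite [RHS]addrC -!addrA; congr (a + _).
by rewrite addrCA.
Qed.

Lemma iter_resolvent_linear n r : linear (iter n (J r)).
Proof. by elim: n => [//|n IH] a f g; rewrite /= IH linearP. Qed.

HB.instance Definition _ n r :=
  GRing.isLinear.Build R[i] E E *:%R (iter n (J r)) (iter_resolvent_linear n r).

Lemma iter_resolvent_contr n r f : rnorm (iter n (J r) f) <= rnorm f.
Proof. by elim: n => [//|n IH]; rewrite iterS (le_trans (J1 _ _)). Qed.

Lemma iter_resolvent_comm n r s f : J r (iter n (J s) f) = iter n (J s) (J r f).
Proof. by elim: n => [//|n IH]; rewrite !iterS resolvent_comm IH. Qed.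

Lemma iter_resolvent_comp n r s f :
  iter n (J r \o J s) f = iter n (J r) (iter n (J s) f).
Proof.
by elim: n f => [//|n IH] f; rewrite iterSr IH /= -iter_resolvent_comm -!iterSr.
Qed.

Lemma iter_resolvent_dist n r f g : 0 <= r -> A (f, g) ->
  rnorm (iter n (J r) f - f) <= n%:R * r * rnorm g.
Proof.
move=> r0 fg; elim: n => [|n IH]; first by rewrite subrr rnorm0 !mul0r.
rewrite iterS (le_trans (rnorm_trans (J r f) _ _))// -linearB.
rewrite -natr1 !mulrDl mul1r lerD ?(le_trans (J1 _ _))//.
by rewrite rnormB resolvent_dist.
Qed.

(** Telescoping: the n factors are exchanged one at a time, each at the cost given
    by [resolvent_split]; the remaining factors do not enlarge it. *)
Lemma iter_resolvent_split n r s f h : 0 <= r -> 0 <= s -> rel_sqr A f h ->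
  rnorm (iter n (J (r + s)) f - iter n (J r \o J s) f) <= n%:R * (r * s) * rnorm h.
Proof.
move=> r0 s0; elim: n f h => [|n IH] f h fh.
  by rewrite subrr rnorm0 !mul0r.
rewrite !iterSr (le_trans (rnorm_trans (iter n (J (r + s)) (J r (J s f))) _ _))//.
rewrite -natr1 !mulrDl mul1r [leRHS]addrC lerD//; last first.
  have := IH _ _ (rel_sqr_resolvent r _ _ (rel_sqr_resolvent s _ _ fh)).
  move=> /le_trans->//; rewrite ler_wpM2l ?mulr_ge0// (le_trans (J1 _ _))//.
rewrite -linearB (le_trans (iter_resolvent_contr _ _ _))//.
rewrite (resolvent_split r s f h)// rnormZ ger0_norm ?mulr_ge0//.
rewrite ler_wpM2l ?mulr_ge0//.
by rewrite !(le_trans (J1 _ _)).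
Qed.

End Resolvent.

(** * The semigroup as a limit of Euler approximations *)

Section Semigroup.
Context {R : realType} {E : completeNormedModType R[i]} {A : set (E * E)}
  {J : R -> {linear E -> E}} (AJ : resolvent_family A J).
Implicit Types (f g h u v : E) (r s t e : R).

Definition euler k t f := iter (2 ^ k)%N (J (t / 2 ^+ k)) f.

Definition euler_lim t f : E := lim (euler k t f @[k --> \oo]).

Lemma euler_neg k t f : t <= 0 -> euler k t f = f.
Proof.
move=> t0; apply: iter_fix; apply: (resolvent_id AJ).
by rewrite pmulr_lle0 ?invr_gt0 ?exprn_gt0//.
Qed.

Lemma euler_contr k t f : rnorm (euler k t f) <= rnorm f.
Proof. exact: (iter_resolvent_contr AJ). Qed.

Lemma eulerB k t f g : euler k t (f - g) = euler k t f - euler k t g.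
Proof. exact: linearB. Qed.

(** One step of length t / 2^k against two steps of half that length. *)
Lemma euler_refine k t f h : 0 <= t -> rel_sqr A f h ->
  rnorm (euler k t f - euler k.+1 t f) <= t ^+ 2 / 4 * rnorm h / 2 ^+ k.
Proof.
move=> t0 fh; pose r := t / 2 ^+ k.+1.
have r0 : 0 <= r by rewrite divr_ge0// exprn_ge0.
have rr : t / 2 ^+ k = r + r.
  by rewrite /r exprS; field; rewrite expf_neq0//.
have := iter_resolvent_split AJ (2 ^ k) r r f h r0 r0 fh.
rewrite /euler rr expnSr iterM natrX => /le_trans; apply.
rewrite le_eqVlt; apply/orP; left; apply/eqP.
by rewrite /r exprS; field; rewrite expf_neq0//.
Qed.

Lemma euler_dist k j t f h : 0 <= t -> rel_sqr A f h ->
  rnorm (euler k t f - euler (k + j) t f) <= t ^+ 2 / 2 * rnorm h / 2 ^+ k.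
Proof.
move=> t0 fh.
(* The factor 1 - 2^-j is the partial geometric sum of the refinement errors;
   it makes the induction on j close. *)
apply: (@le_trans _ _
  (t ^+ 2 / 2 * rnorm h / 2 ^+ k * (1 - 2 ^- j))); last first.
  by rewrite ler_piMr ?gerBl ?invr_ge0 ?exprn_ge0//
     ?mulr_ge0 ?invr_ge0 ?exprn_ge0 ?rnorm_ge0.
elim: j => [|j IH]; first by rewrite addn0 subrr rnorm0 expr0 invr1 subrr mulr0.
rewrite (le_trans (rnorm_trans (euler (k + j) t f) _ _))//.
rewrite addnS (le_trans (lerD IH (euler_refine _ _ _ _ t0 fh)))//.
rewrite le_eqVlt; apply/orP; left; apply/eqP.
by rewrite [2 ^+ j.+1]exprS [2 ^+ (k + j)]exprD; field; rewrite !expf_neq0//.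
Qed.

Lemma euler_cvg t f : euler k t f @[k --> \oo] --> euler_lim t f.
Proof.
have [t0|t0] := leP t 0.
  have eE : (fun k => euler k t f) = cst f by apply/funext => k; exact: euler_neg.
  by rewrite /euler_lim eE; exact: is_cvg_cst.
apply: cauchy_cvg; apply: cauchy_exP => _/posnumP[e'].
have eE : e'%:num = (complex.Re e'%:num)%:C by rewrite RRe_real// gtr0_real.
have : 0 < e'%:num by []; rewrite eE ltcR; move: (complex.Re _) => e e0.
have e3 : 0 < e / 3 by rewrite divr_gt0.
have [u [h [uh fu]]] := rel_sqr_dense AJ f _ e3.
have [K HK] := geometric_small (t ^+ 2 / 2 * rnorm h) _ e3.
exists (euler K t f); exists K => // k /= Kk.
rewrite -ball_normE /ball_/= rnormE ltcR.
have := rnorm_trans (euler K t u) (euler K t f) (euler k t f).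
have := rnorm_trans (euler k t u) (euler K t u) (euler k t f).
have := euler_dist K (k - K) _ _ _ (ltW t0) uh; rewrite subnKC//.
have := HK K (leqnn _).
have := euler_contr k t (u - f); rewrite eulerB [X in _ <= X]rnormB.
have := euler_contr K t (f - u); rewrite eulerB.
lra.
Qed.

Lemma euler_lim_linear t : linear (euler_lim t).
Proof.
move=> a f g; apply: cvg_lim; first exact: norm_hausdorff.
rewrite (_ : (fun k => _) = (fun k => a *: euler k t f + euler k t g)).
  by apply: cvgD; [apply: cvgZl_tmp|]; exact: euler_cvg.
by apply/funext => k; exact: (iter_resolvent_linear (J := J)).
Qed.

Definition semigroup t : {linear E -> E} :=
  HB.pack (euler_lim t)
    (GRing.isLinear.Build R[i] E E *:%R (euler_lim t) (euler_lim_linear t)).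

Lemma semigroup_cvg t f : euler k t f @[k --> \oo] --> semigroup t f.
Proof. exact: euler_cvg. Qed.

Lemma semigroup_contr t f : rnorm (semigroup t f) <= rnorm f.
Proof.
rewrite -rnormN -sub0r; apply: rnorm_lim_le (semigroup_cvg t f) _.
by near=> k; rewrite sub0r rnormN euler_contr.
Unshelve. all: by end_near. Qed.

Lemma semigroup_dist t f g : 0 <= t -> A (f, g) ->
  rnorm (semigroup t f - f) <= t * rnorm g.
Proof.
move=> t0 fg; rewrite rnormB; apply: rnorm_lim_le (semigroup_cvg t f) _.
near=> k; rewrite rnormB.
have tk : 0 <= t / 2 ^+ k by rewrite divr_ge0// exprn_ge0.
apply: (le_trans (iter_resolvent_dist AJ _ _ _ _ tk fg)).
by rewrite natrX mulrCA divff ?mulr1// expf_neq0.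
Unshelve. all: by end_near. Qed.

Lemma semigroup_euler_dist k t f h : 0 <= t -> rel_sqr A f h ->
  rnorm (euler k t f - semigroup t f) <= t ^+ 2 / 2 * rnorm h / 2 ^+ k.
Proof.
move=> t0 fh; apply: rnorm_lim_le (semigroup_cvg t f) _.
exists k => // j /= kj; rewrite -(subnKC kj); exact: euler_dist.
Qed.

Lemma semigroup0 f : semigroup 0 f = f.
Proof.
rewrite -[LHS]/(euler_lim 0 f); apply: cvg_lim; first exact: norm_hausdorff.
by under eq_fun do rewrite euler_neg//; exact: cvg_cst.
Qed.

(** The products of Euler approximations at s and at t regroup, since resolvents
    commute, into 2^k factors J (s / 2^k) J (t / 2^k), which differ from the Euler
    approximation at s + t by at most s t |A^2 f| / 2^k on the domain of A^2. *)
Lemma semigroupD s t f : 0 <= s -> 0 <= t ->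
  semigroup (s + t) f = semigroup s (semigroup t f).
Proof.
move=> s0 t0; apply/eqP; rewrite -subr_eq0; apply/eqP/rnorm_eq0/eqP.
rewrite eq_le rnorm_ge0 andbT; apply/ler_addgt0Pr => e e0; rewrite add0r.
have e6 : 0 < e / 6 by rewrite divr_gt0.
have [u [h [uh fu]]] := rel_sqr_dense AJ f _ e6.
have [K HK] := geometric_small (s * t * rnorm h) _ e6.
near \oo => k.
have tk : 0 <= t / 2 ^+ k by rewrite divr_ge0// exprn_ge0.
have sk : 0 <= s / 2 ^+ k by rewrite divr_ge0// exprn_ge0.
have : s * t * rnorm h / 2 ^+ k < e / 6 by apply: HK; near: k; exists K.
have := iter_resolvent_split AJ (2 ^ k) _ _ _ _ sk tk uh.
rewrite -mulrDl (iter_resolvent_comp AJ) -/(euler k _ _) -/(euler k t u).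
rewrite -/(euler k s _) natrX.
have -> : 2 ^+ k * (s / 2 ^+ k * (t / 2 ^+ k)) * rnorm h =
          s * t * rnorm h / 2 ^+ k by field; rewrite expf_neq0.
have : rnorm (semigroup (s + t) u - euler k (s + t) u) < e / 6.
  by near: k; move/cvg_rnormP: (semigroup_cvg (s + t) u); apply.
have : rnorm (semigroup t u - euler k t u) < e / 6.
  by near: k; move/cvg_rnormP: (semigroup_cvg t u); apply.
have : rnorm (semigroup s (semigroup t u) - euler k s (semigroup t u)) < e / 6.
  by near: k; move/cvg_rnormP: (semigroup_cvg s (semigroup t u)); apply.
have := euler_contr k s (semigroup t u - euler k t u); rewrite eulerB.
have := semigroup_contr s (semigroup t u - semigroup t f); rewrite linearB.
have := semigroup_contr t (u - f); rewrite linearB [X in _ <= X]rnormB.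
have := semigroup_contr (s + t) (f - u); rewrite linearB.
set a := semigroup (s + t) f; set b := semigroup (s + t) u.
set c := euler k (s + t) u; set d := euler k s (euler k t u).
set p := euler k s (semigroup t u); set q := semigroup s (semigroup t u).
set z := semigroup s (semigroup t f).
(* The path a, b, c, d, p, q, z runs from T (s + t) f to T s (T t f). *)
have := rnorm_trans b a z; have := rnorm_trans c b z.
have := rnorm_trans d c z; have := rnorm_trans p d z.
have := rnorm_trans q p z; rewrite (rnormB d p) (rnormB p q).
lra.
Unshelve. all: by end_near. Qed.


Lemma semigroup_small f e : 0 < e -> exists2 d, 0 < d &
  forall t, 0 <= t < d -> rnorm (semigroup t f - f) < e.
Proof.
move=> e0; have e4 : 0 < e / 4 by rewrite divr_gt0.
have [u [v [uv fu]]] := resolvent_dense AJ f _ e4.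
have v1 : 0 < rnorm v + 1 by rewrite ltr_wpDl// rnorm_ge0.
exists (e / 4 / (rnorm v + 1)) => [|t /andP[t0]]; first by rewrite divr_gt0.
rewrite ltr_pdivlMr// mulrDr mulr1 => tv.
have := semigroup_dist _ _ _ t0 uv.
have := semigroup_contr t (f - u); rewrite linearB/=.
have := rnorm_trans (semigroup t u) (semigroup t f) f.
have := rnorm_trans u (semigroup t u) f; rewrite (rnormB u f).
lra.
Qed.

Lemma semigroup_modulus s t f : 0 <= s -> 0 <= t ->
  rnorm (semigroup s f - semigroup t f) <= rnorm (semigroup `|s - t| f - f).
Proof.
wlog st : s t / t <= s => [H s0 t0|s0 t0].
  by have [/H|/ltW/H] := leP t s; [|rewrite distrC rnormB]; exact.
rewrite ger0_norm ?subr_ge0// -{1}(subrKC t s) (semigroupD t) ?subr_ge0//.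
by rewrite -linearB semigroup_contr.
Qed.

Lemma semigroup_C0 : C0_semigroup semigroup.
Proof.
split=> [t _|||f]; [|exact: semigroup0|by move=> *; exact: semigroupD|].
  exact/contraction_continuous/semigroup_contr.
apply/subspace_continuousP => s /= s0; apply/cvg_rnormP => e e0.
have [d d0 sd] := semigroup_small f _ e0.
near=> t; apply: (le_lt_trans (semigroup_modulus _ _ _ s0 _)).
  by near: t; exact: withinT.
apply: sd; rewrite normr_ge0/=; near: t; apply: cvg_within.
exact: nbhsx_ballx.
Unshelve. all: by end_near. Qed.

(** * The generator *)

Definition diff_quot t f : E := t^-1%:C *: (semigroup t f - f).

Lemma diff_quotB t f g : diff_quot t (f - g) = diff_quot t f - diff_quot t g.
Proof.
rewrite /diff_quot (linearB (semigroup t)) -scalerBr; congr (_ *: _).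
by rewrite !opprB addrACA [RHS]addrACA [- f + _]addrC.
Qed.

Lemma rnormZV t f : 0 < t -> rnorm (t^-1%:C *: f) = t^-1 * rnorm f.
Proof. by move=> t0; rewrite rnormZ ger0_norm// invr_ge0 ltW. Qed.

Lemma diff_quot_le t f g : 0 < t -> A (f, g) -> rnorm (diff_quot t f) <= rnorm g.
Proof.
move=> t0 fg; rewrite rnormZV// ler_pdivrMl//; apply: semigroup_dist => //.
exact: ltW.
Qed.

(** The difference quotient at f is that of J t, which is - J t g, up to the
    error of a single Euler step, which is quadratic in t. *)
Lemma diff_quot_dist t f g h : 0 < t -> A (f, g) -> A (g, h) ->
  rnorm (diff_quot t f + g) <= 2 * (t * rnorm h).
Proof.
move=> t0 fg gh; have fh : rel_sqr A f h by exists g.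
have -> : diff_quot t f + g =
  t^-1%:C *: (semigroup t f - J t f) + (g - J t g).
  rewrite /diff_quot -(subrKA (J t f) (semigroup t f) (- f)) scalerDr.
  rewrite -addrA; congr (_ + _).
  rewrite -[J t f - f]opprB (resolvent_sub AJ t f g)// ?ltW//.
  rewrite scalerN scalerA -rmorphM.
  by rewrite mulVf ?gt_eqF// scale1r addrC.
have := rnormD (t^-1%:C *: (semigroup t f - J t f)) (g - J t g).
have := resolvent_dist AJ t g h (ltW t0) gh; rewrite rnormZV//.
have H : rnorm (semigroup t f - J t f) <= t ^+ 2 / 2 * rnorm h.
  have := semigroup_euler_dist 0 t f h (ltW t0) fh.
  by rewrite rnormB /euler expn0 expr0 !divr1.
have : t^-1 * rnorm (semigroup t f - J t f) <= t * rnorm h / 2.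
  by rewrite ler_pdivrMl// (le_trans H)//; lra.
have : 0 <= t * rnorm h by rewrite mulr_ge0 ?rnorm_ge0// ltW.
lra.
Qed.

(** The point f is replaced by J r f, which lies in the domain of the square, where
    [diff_quot_dist] gives the limit; the error of the replacement is uniform in t
    by [diff_quot_le]. *)
Lemma rel_generator f g : A (f, g) -> diff_quot t f @[t --> 0^'+] --> - g.
Proof.
move=> fg; apply/cvg_rnormP => e e0.
have e4 : 0 < e / 4 by rewrite divr_gt0.
have [r r0 gr] := resolvent_approx AJ g _ e4.
set h := r^-1%:C *: (g - J r g).
have uv : A (J r f, J r g) by exact: (rel_resolvent AJ).
have vh : A (J r g, h) by exact: (resolvent_dom AJ).
have fuv : A (f - J r f, g - J r g).
  have := rel_linear AJ (- 1) _ _ _ _ uv fg.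
  by rewrite !scaleN1r [- _ + f]addrC [- _ + g]addrC.
have h1 : 0 < rnorm h + 1 by rewrite ltr_wpDl// rnorm_ge0.
near=> t.
have t0 : 0 < t by near: t; exact: nbhs_right_gt.
have : t < e / 4 / (rnorm h + 1).
  by near: t; apply: nbhs_right_lt; rewrite divr_gt0.
rewrite ltr_pdivlMr// mulrDr mulr1.
have := diff_quot_dist _ _ _ _ t0 uv vh.
have := diff_quot_le _ _ _ t0 fuv; rewrite diff_quotB.
have := rnorm_trans (diff_quot t (J r f)) (diff_quot t f) (- g).
have := rnorm_trans (- J r g) (diff_quot t (J r f)) (- g).
rewrite !opprK -[- J r g + g]addrC (rnormB (- g)) opprK.
lra.
Unshelve. all: by end_near. Qed.

(** With h = J 1 (f - g), the generator G satisfies G f = g and, by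
    [rel_generator], G h = h - (f - g); hence u = f - h satisfies G u = u, that is
    T t u = (1 + t) u + o(t), and |T t u| <= |u| forces u = 0. *)
Lemma generator_rel f g : diff_quot t f @[t --> 0^'+] --> g -> A (f, - g).
Proof.
move=> fg; set h := J 1 (f - g).
have hh : A (h, f - g - h).
  by have := resolvent_dom AJ 1 (f - g) ltr01; rewrite invr1 scale1r.
suff fh : f = h by move: hh; rewrite -fh addrAC subrr sub0r.
apply/eqP; rewrite -subr_eq0; apply/eqP/rnorm_eq0/eqP.
rewrite eq_le rnorm_ge0 andbT; apply/ler_addgt0Pr => e e0; rewrite add0r.
have /cvg_rnormP/(_ _ e0) : diff_quot t (f - h) @[t --> 0^'+] --> f - h.
  under eq_fun do rewrite diff_quotB.
  have -> : f - h = g - - (f - g - h) by rewrite opprK -addrA addrCA addNKr.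
  by apply: cvgB => //; exact: rel_generator.
set u := f - h => uq.
near (0 : R)^'+ => t; have t0 : 0 < t by near: t; exact: nbhs_right_gt.
have : rnorm (u - diff_quot t u) < e by near: t.
rewrite -(ltr_pM2l t0) -[X in X * rnorm _](ger0_norm (ltW t0)) -rnormZ scalerBr.
rewrite scalerA -rmorphM divff ?gt_eqF// scale1r => ut.
have := semigroup_contr t u.
have : rnorm ((1 + t)%:C *: u) = (1 + t) * rnorm u.
  by rewrite rnormZ ger0_norm// addr_ge0// ltW.
have -> : (1 + t)%:C *: u = semigroup t u + (t%:C *: u - (semigroup t u - u)).
  by rewrite rmorphD scalerDl scale1r opprB [_ + (u - _)]addrC addrA subrKC.
have := rnormD (semigroup t u) (t%:C *: u - (semigroup t u - u)).
move=> h1 h2 h3; rewrite -(ler_pM2l t0).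
lra.
Unshelve. all: by end_near. Qed.

End Semigroup.

(** In terms of the resolvents of [A], J r is r^-1 times the inverse of A + r^-1, so
    the bound on that inverse says that J r is a contraction. *)
Theorem hille_yosida {R : realType} {E : completeNormedModType R[i]}
    (A : set (E * E)) :
  (forall f (e : R), 0 < e -> exists u v, A (u, v) /\ rnorm (f - u) < e) ->
  (forall r : R, 0 < r -> exists B : {linear E -> E},
     is_inverse (shift_op A r%:C) B /\ (opnorm B <= r^-1%:E)%E) ->
  exists T : R -> {linear E -> E},
    [/\ C0_semigroup T, generator T = opp_op A &
        forall t : R, 0 <= t -> (opnorm (T t) <= 1)%E].
Proof.
move=> dA resA.
have [J AJ] : exists J, resolvent_family A J.
  have /choice[J HJ] : forall r : R, exists B : {linear E -> E},
      [/\ forall f g, 0 < r -> A (f, g) <-> B (f + r%:C *: g) = f,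
          forall f, r <= 0 -> B f = f & forall f, rnorm (B f) <= rnorm f].
    move=> r; have [r0|r0] := leP r 0.
      by exists idfun; split=> // f g; rewrite ltNge r0.
    have ri0 : 0 < r^-1 by rewrite invr_gt0.
    have [B [iB]] := resA _ ri0.
    rewrite invrK => /(opnorm_rnorm _ _ (ltW r0)) nB.
    exists (r^-1%:C \*: B); split=> [f g _|f|f] /=.
    - have -> : r^-1%:C *: B (f + r%:C *: g) = B (g + r^-1%:C *: f).
        rewrite -linearZ/= scalerDr scalerA -rmorphM mulVf ?gt_eqF//.
        by rewrite scale1r addrC.
      by rewrite -(iB f) /shift_op/= addrK.
    - by [].
    - by rewrite rnormZV// ler_pdivrMl.
  exists J; split=> [r f g r0|r f r0|r f|f e]; last exact: dA.
  - by have [] := HJ r => /(_ f g r0).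
  - by have [_ /(_ f r0)] := HJ r.
  - by have [_ _] := HJ r; apply.
exists (semigroup AJ); split; first exact: semigroup_C0.
  apply/seteqP; split=> -[f g]; first exact: generator_rel.
  by move=> /(rel_generator AJ); rewrite opprK.
move=> t _; apply/(opnorm_rnorm _ _ ler01) => f.
by rewrite mul1r; exact: semigroup_contr.
Qed.

(** * Completeness of l2 and density of finitely supported functions *)

Section L2.
Context {R : realType} {V : countType} {m : V -> {posnum R}}.
Implicit Types (u v : l2 m) (f : V -> R[i]).

Lemma rnorm_l2 u : rnorm u = l2norm u.
Proof. by []. Qed.

Lemma l2normE u : l2norm u ^+ 2 = fine (sqsum m u).
Proof. by rewrite sqr_sqrtr// fine_ge0// sqsum_ge0. Qed.

Lemma wsqE f x :
  wsq m f x = (m x)%:num * (complex.Re (f x) ^+ 2 + complex.Im (f x) ^+ 2).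
Proof.
by rewrite /wsq; case: (f x) => a b; rewrite /= sqr_sqrtr// addr_ge0 ?sqr_ge0.
Qed.

Lemma sqsum_le_l2norm u (X : set V) : finite_set X ->
  \sum_(x \in X) wsq m u x <= l2norm u ^+ 2.
Proof.
move=> finX; rewrite l2normE -lee_fin -sqsum_fin; last exact: (valP u).
by rewrite -fsumEFin//; apply: ereal_sup_ubound; exists X.
Qed.

Lemma l2norm_le u (c : R) : 0 <= c ->
  (forall X : set V, finite_set X -> \sum_(x \in X) wsq m u x <= c ^+ 2) ->
  l2norm u <= c.
Proof.
move=> c0 uc; rewrite -(@ler_pXn2r _ 2) ?nnegrE ?sqrtr_ge0// l2normE.
rewrite -lee_fin -sqsum_fin; last exact: (valP u).
by apply: ge_ereal_sup => _ [X [finX _] <-]; rewrite fsumEFin// lee_fin uc.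
Qed.

Lemma sqsummable_le f (c : R) :
  (forall X : set V, finite_set X -> \sum_(x \in X) wsq m f x <= c) ->
  f \in sqsummable m.
Proof.
move=> fc; apply/sqsummableP; apply: (@le_lt_trans _ _ c%:E); last exact: ltry.
by apply: ge_ereal_sup => _ [X [finX _] <-]; rewrite fsumEFin// lee_fin fc.
Qed.

(** The truncation of u to a finite set X is orthogonal to the remainder, so the
    squared norm of the remainder is the part of the squared norm of u that the
    finite sum over X misses. *)
Lemma finite_support_approx u (e : R) : 0 < e ->
  exists v, finite_set [set x | v x != 0] /\ rnorm (u - v) < e.
Proof.
move=> e0.
have [X finX eX] : exists2 X : set V, finite_set X &
    l2norm u ^+ 2 - e ^+ 2 / 4 < \sum_(x \in X) wsq m u x.
  have : ((l2norm u ^+ 2 - e ^+ 2 / 4)%:E < sqsum m u)%E.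
    rewrite sqsum_fin; last exact: (valP u).
    by rewrite lte_fin l2normE ltrBlDr ltrDl divr_gt0 ?exprn_gt0.
  move=> /ereal_sup_gt[_ [X [finX _] <-]].
  by rewrite fsumEFin// lte_fin => h; exists X.
pose f x := if x \in X then u x else 0.
have ff : finite_set [set x | f x != 0].
  apply: sub_finite_set finX => x /=; rewrite /f.
  by case: ifPn => [/set_mem//|]; rewrite eqxx.
pose v : l2 m := L2 (finite_support_sqsummable m ff).
exists v; split => //.
have pyth : l2norm u ^+ 2 = l2norm (u - v) ^+ 2 + l2norm v ^+ 2.
  apply: EFin_inj; rewrite EFinD !l2normE -!sqsum_fin ?(valP (_ : l2 m))//.
  rewrite /sqsum -esumD; do ?by move=> x _; rewrite lee_fin wsq_ge0.
  apply: eq_esum => x _; rewrite -EFinD; congr (_%:E).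
  rewrite /wsq -[v x]/(f x) -[(u - v) x]/(u x - f x) /f.
  by case: ifPn => _; rewrite ?subrr ?subr0 normc0 expr0n mulr0 ?addr0 ?add0r.
have vX : \sum_(x \in X) wsq m u x <= l2norm v ^+ 2.
  apply: le_trans (sqsum_le_l2norm v X finX).
  by under [leRHS]eq_fsbigr => x xX do rewrite /wsq -[v x]/(f x) /f xX.
rewrite rnorm_l2 -(@ltr_pXn2r _ 2) ?nnegrE ?sqrtr_ge0 ?ltW//.
have : 0 < e ^+ 2 by rewrite exprn_gt0.
lra.
Qed.

Lemma normc_le_l2norm u x :
  Num.sqrt (m x)%:num * normc (u x) <= l2norm u.
Proof.
have n0 : 0 <= normc (u x) by case: (u x) => ? ?; exact: sqrtr_ge0.
rewrite -(@ler_pXn2r _ 2) ?nnegrE ?mulr_ge0 ?sqrtr_ge0//.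
by rewrite exprMn sqr_sqrtr//; exact: wsq_le_l2norm.
Qed.

(** A Cauchy filter converges pointwise to some f.  The norm estimates along
    the filter are bounds on sums over finite sets, which survive the pointwise
    limit; so f is square summable and the convergence holds in norm. *)
Lemma l2_complete (F : set_system (l2 m)) : ProperFilter F -> cauchy F -> cvg F.
Proof.
move=> FF /cauchyP cF.
have ReB (z w : R[i]) : complex.Re (z - w) = complex.Re z - complex.Re w.
  by case: z w => ? ? [].
have ImB (z w : R[i]) : complex.Im (z - w) = complex.Im z - complex.Im w.
  by case: z w => ? ? [].
have Fball (e : R) : 0 < e -> exists u, \forall v \near F, l2norm (u - v) < e.
  rewrite -ltcR => /cF[u Fu]; exists u; apply: filterS Fu => v.
  by rewrite -ball_normE /ball_/= rnormE ltcR.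
have evcvg (k : R[i] -> R) x : (forall z w, k (z - w) = k z - k w) ->
    (forall z, `|k z| <= normc z) -> cvg ((fun u : l2 m => k (u x)) @ F).
  move=> kB kn; apply: cauchy_cvg; apply: cauchy_exP => e e0.
  have s0 : 0 < Num.sqrt (m x)%:num by rewrite sqrtr_gt0.
  have [|u Fu] := Fball (Num.sqrt (m x)%:num * e); first by rewrite mulr_gt0.
  exists (k (u x)); apply: filterS Fu => v uv.
  rewrite -ball_normE /ball_/= -kB (le_lt_trans (kn _))// -(ltr_pM2l s0).
  exact: le_lt_trans (normc_le_l2norm (u - v) x) uv.
pose f x := lim ((fun u : l2 m => complex.Re (u x)) @ F) +i*
    lim ((fun u : l2 m => complex.Im (u x)) @ F).
have Fsum u (X : set V) : finite_set X ->
    ((fun v : l2 m => \sum_(x \in X) wsq m (u - v) x) @ F) -->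
    \sum_(x \in X) wsq m ((u : V -> R[i]) - f) x.
  move=> finX; rewrite fsbig_finite//=; under eq_fun do rewrite fsbig_finite//=.
  apply: cvg_big => [|x _]; first exact: add_continuous.
  rewrite wsqE; under eq_fun do rewrite wsqE.
  have lim1 (k : R[i] -> R) : (forall z w, k (z - w) = k z - k w) ->
      (forall z, `|k z| <= normc z) ->
      ((fun v : l2 m => k ((u - v) x) ^+ 2) @ F) -->
      (k (u x) - lim ((fun v : l2 m => k (v x)) @ F)) ^+ 2.
    move=> kB kn; apply: (continuous_cvg _ (@exprn_continuous R 2 _)).
    under eq_fun do rewrite kB.
    by apply: cvgB; [exact: cvg_cst|exact: evcvg].
  rewrite -[((u : V -> R[i]) - f) x]/(u x - f x) ReB ImB.
  apply: cvgZl_tmp; apply: cvgD.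
    apply: (lim1 (@complex.Re R)) => // -[a c].
    by rewrite /= -sqrtr_sqr ler_wsqrtr// lerDl sqr_ge0.
  apply: (lim1 (@complex.Im R)) => // -[a c].
  by rewrite /= -sqrtr_sqr ler_wsqrtr// lerDr sqr_ge0.
have Fle u (e : R) : 0 <= e -> (\forall v \near F, l2norm (u - v) < e) ->
    forall X : set V, finite_set X ->
    \sum_(x \in X) wsq m ((u : V -> R[i]) - f) x <= e ^+ 2.
  move=> e0 ue X finX; apply: (cvgr_to_le (Fsum u X finX)).
  apply: filterS ue => v uv; apply: (le_trans (sqsum_le_l2norm (u - v) X finX)).
  by rewrite ler_pXn2r ?nnegrE ?sqrtr_ge0// ltW.
have fs : f \in sqsummable m.
  have [u Fu] := Fball 1 ltr01.
  have := sqsummable_le _ _ (Fle _ _ ler01 Fu).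
  move=> /(rpredB (valP u)); rewrite opprB addrC subrK; exact.
apply/cvg_ex; exists (L2 fs); apply/cvg_rnormP => e e0.
have e2 : 0 < e / 2 by rewrite divr_gt0.
have [u Fu] := Fball _ e2.
have uf : l2norm (u - L2 fs) <= e / 2.
  by apply: l2norm_le; [exact: ltW|exact: (Fle _ _ (ltW e2) Fu)].
apply: filterS Fu => v uv.
rewrite (le_lt_trans (rnorm_trans u _ _))// [ltRHS]splitr ler_ltD//.
by rewrite rnormB.
Qed.

End L2.

HB.instance Definition _ (R : realType) (V : countType) (m : V -> {posnum R}) :=
  Uniform_isComplete.Build (l2 m) (@l2_complete R V m).

(** * The semigroup of the directed Laplacian *)

Theorem theorem5p1p3 (R : realType) (V : countType) (m : V -> {posnum R})
    (b : V -> V -> {nonneg R}) (V_infinite : infinite_set [set: V])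
    (b_noloop : forall x, (b x x)%:num = 0)
    (b_locally_finite : locally_finite b)
    (b_weakly_connected : weakly_connected b)
    (b_outgoing : forall x, 0 < \sum_(y \in [set: V]) (b x y)%:num)
    (b_kirchhoff : kirchhoff b)
    (Delta_m_accretive : m_accretive (closure (laplacian b m))) :
  exists T : R -> {linear l2 m -> l2 m},
    [/\ C0_semigroup T,
        generator T = opp_op (closure (laplacian b m)) &
        forall t : R, 0 <= t -> (opnorm (T t) <= 1)%E].
Proof.
have [_ left_resolvent resolvent_le] := Delta_m_accretive.
apply: hille_yosida => [f e e0|r r0].
  have [u [fu ue]] := finite_support_approx f _ e0.
  have [u' [v [u'E uv]]] := lap_domain m b_locally_finite fu.
  exists u, v; split=> //; apply: subset_closure.
  by rewrite -(l2P u'E).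
have [|B [_ iB]] := left_resolvent (- r%:C); first by rewrite /= oppr_lt0.
by exists B; rewrite opprK in iB; split=> //; exact: (resolvent_le r%:C).
Qed.
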